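(* Let $g_0,\dots,g_{n_c}:\mathbb{R}^n\to\mathbb{R}^n$ be locally Lipschitz continuous vector fields, let $\mathbb{X}\subsetneq\mathbb{R}^n$ be compact, and let $\mathbb{V}=\operatorname{span}\{\psi_1,\dots,\psi_N\}$ be the space spanned by a dictionary of observables. Suppose that, for each autonomous system with constant control $u\equiv e_i$, $i\in\{0,\dots,n_c\}$, the data is sampled i.i.d. on $\mathbb{X}$ with respect to the Lebesgue measure, and suppose that $\mathbb{U}\subset\mathbb{R}^{n_c}$ is bounded. Then, for every error bound $\varepsilon>0$ and every probabilistic tolerance $\delta\in(0,1)$, there is a number $\underline{m}=\mathcal{O}\!\left(\frac{N^2}{\varepsilon^2\delta}\right)$ such that, if the number $m$ of data points satisfies $m\ge\underline{m}$, then for all measurable control functions $u:[0,\infty)\to\mathbb{U}$ the probabilistic error bound $$\mathbb{P}\big(\|\mathcal{L}^u_{\mathbb{V}}(t)-\tilde{\mathcal{L}}^u_m(t)\|_F\le\varepsilon\big)\ge 1-\delta\qquad\forall\,t\ge 0$$ holds, where $\|\cdot\|_F$ denotes the Frobenius norm. (The number $\underline{m}$ does not depend on $u$ or $t$.)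
   Context: Control system: $\dot x(t)=g_0(x(t))+\sum_{i=1}^{n_c}g_i(x(t))u_i(t)$, $x(0)=x_0$. Put $e_0=0\in\mathbb{R}^{n_c}$ and let $e_1,\dots,e_{n_c}$ be the standard unit vectors of $\mathbb{R}^{n_c}$. $L^2(\mathbb{X})$ is taken with respect to Lebesgue measure. ''Sampled i.i.d. on $\mathbb{X}$ w.r.t. the Lebesgue measure'' means independent samples, each distributed according to the normalized Lebesgue measure on $\mathbb{X}$. Generators: for a constant control $\bar u$ with right-hand side $f=g_0+\sum_i g_i\bar u_i$, the Koopman semigroup is $(\mathcal{K}^t\varphi)(x_0)=\varphi(x(t;x_0))$ for $\varphi\in L^2(\mathbb{X})$, on the maximal interval of existence of the solution $x(\cdot;x_0)$. The Koopman generator is $\mathcal{L}\varphi=\lim_{t\to0}\frac{(\mathcal{K}^t-\mathrm{Id})\varphi}{t}$ with domain $D(\mathcal{L})\subset L^2(\mathbb{X})$; on dictionary functions $(\mathcal{L}\psi)(x)=\langle f(x),\nabla\psi(x)\rangle$. $\mathcal{L}^{e_i}$ denotes the generator for $u\equiv e_i$, so $\mathcal{L}^{e_0}=\mathcal{L}^0$ has $f=g_0$ and $\mathcal{L}^{e_i}$ has $f=g_0+g_i$ for $i\ge1$. Dictionary: $\psi_1,\dots,\psi_N$ lie in the domains of all $\mathcal{L}^{e_i}$, $i\in\{0,\dots,n_c\}$, and are such that the Gram matrix $C\in\mathbb{R}^{N\times N}$, $C_{k,j}=\langle\psi_k,\psi_j\rangle_{L^2(\mathbb{X})}$, is invertible.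 With $P_{\mathbb{V}}$ the orthogonal projection onto $\mathbb{V}$, the Galerkin projection $\mathcal{L}^{e_i}_{\mathbb{V}}=P_{\mathbb{V}}\mathcal{L}^{e_i}|_{\mathbb{V}}$ is identified with its matrix $C^{-1}A^{(i)}$ in the basis $\psi_1,\dots,\psi_N$, where $A^{(i)}_{k,j}=\langle\psi_k,\mathcal{L}^{e_i}\psi_j\rangle_{L^2(\mathbb{X})}$. Data-based estimator: given data points $x_1,\dots,x_m\in\mathbb{X}$ for the system with $u\equiv e_i$, set $(\tilde C_m)_{k,j}=\frac1m\sum_{l=1}^m\psi_k(x_l)\psi_j(x_l)$, $(\tilde A_m)_{k,j}=\frac1m\sum_{l=1}^m\psi_k(x_l)(\mathcal{L}^{e_i}\psi_j)(x_l)$ and $\tilde{\mathcal{L}}^{e_i}_m=\tilde C_m^{-1}\tilde A_m$. For a control $u$: $$\mathcal{L}^u_{\mathbb{V}}(t)=\mathcal{L}^0_{\mathbb{V}}+\sum_{i=1}^{n_c}u_i(t)\big(\mathcal{L}^{e_i}_{\mathbb{V}}-\mathcal{L}^0_{\mathbb{V}}\big),\qquad \tilde{\mathcal{L}}^u_m(t)=\tilde{\mathcal{L}}^0_m+\sum_{i=1}^{n_c}u_i(t)\big(\tilde{\mathcal{L}}^{e_i}_m-\tilde{\mathcal{L}}^0_m\big).$$ The $\mathcal{O}$-notation refers to small $\varepsilon,\delta$; the implied constant may depend on the vector fields, $\mathbb{X}$, $\mathbb{U}$, $n_c$ and the dictionary functions, but not on $\varepsilon$, $\delta$ or $u$. 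*)

(* Defs.v *)
From HB Require Import structures.
From mathcomp Require Import all_boot all_order all_algebra.
From mathcomp Require Import all_classical all_reals all_analysis.
Set Implicit Arguments.
Unset Strict Implicit.
Unset Printing Implicit Defensive.
Import Order.TTheory GRing.Theory Num.Theory.
Import numFieldNormedType.Exports.
Local Open Scope classical_set_scope.
Local Open Scope ring_scope.

(* The sigma-algebra on row vectors generated by the coordinates; over a
   realType it is the Borel sigma-algebra of R^n. *)
Section measurable_rV.
Context {R : realType}.
Variable n : nat.

Let coord : 'I_n -> 'rV[R]_n -> R := fun i v => v 0 i.

Let rV_set0 : g_sigma_preimage coord set0.
Proof. exact: sigma_algebra0. Qed.

Let rV_setC A : g_sigma_preimage coord A -> g_sigma_preimage coord (~` A).
Proof. exact: sigma_algebraC. Qed.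

Let rV_bigcup (F : _^nat) : (forall i, g_sigma_preimage coord (F i)) ->
  g_sigma_preimage coord (\bigcup_i (F i)).
Proof. exact: sigma_algebra_bigcup. Qed.

HB.instance Definition _ := @isMeasurable.Build default_measure_display
  'rV[R]_n (g_sigma_preimage coord) rV_set0 rV_setC rV_bigcup.

End measurable_rV.

Lemma measurable_coord_rV (R : realType) n (i : 'I_n) :
  measurable_fun [set: 'rV[R]_n] (fun v => v 0 i).
Proof.
move=> _ Y mY; rewrite setTI; apply: sub_sigma_algebra => /=.
rewrite -bigcup_seq/=; exists i => /=; first by rewrite mem_index_enum.
by exists Y => //; rewrite setTI.
Qed.

Lemma measurable_fun_rVP d (T : measurableType d) (R : realType) n
    (f : T -> 'rV[R]_n) :
  measurable_fun [set: T] f <->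
  forall i, measurable_fun [set: T] (fun x => f x 0 i).
Proof.
split=> [mf i|mf].
  by apply: (measurableT_comp (measurable_coord_rV i)).
suff: preimage_set_system setT f measurable `<=` measurable.
  by move=> h _ A mA; apply: h; exists A.
rewrite [X in preimage_set_system _ _ X]/measurable/= -g_sigma_preimage_comp.
apply: smallest_sub; first exact: sigma_algebra_measurable.
move=> A; rewrite -bigcup_seq => -[i _ [B mB <-]].
exact: mf.
Qed.

Definition cons_rV (R : realType) n (p : R * 'rV[R]_n) : 'rV[R]_n.+1 :=
  row_mx (p.1)%:M p.2.

Lemma measurable_cons_rV (R : realType) n :
  measurable_fun setT (@cons_rV R n).
Proof.
apply/measurable_fun_rVP => i.
rewrite /cons_rV; case: (splitP (i : 'I_(1 + n))) => j ij.
  rewrite (_ : (fun _ => _) = fst)//; apply/funext => p /=.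
  have -> : i = lshift n j :> 'I_(1 + n) by exact/val_inj.
  by rewrite -[LHS]/(row_mx p.1%:M p.2 0 (lshift n j)) row_mxEl ord1 mxE eqxx mulr1n.
rewrite (_ : (fun _ => _) = (fun v : 'rV[R]_n => v 0 j) \o snd).
  exact: (measurableT_comp (measurable_coord_rV j)).
apply/funext => p /=.
have -> : i = rshift 1 j :> 'I_(1 + n) by exact/val_inj.
by rewrite -[LHS]/(row_mx p.1%:M p.2 0 (rshift 1 j)) row_mxEr.
Qed.

Definition uncons_rV (R : realType) n (v : 'rV[R]_n.+1) : R * 'rV[R]_n :=
  (v 0 ord0, \row_j v 0 (lift ord0 j)).

Lemma measurable_uncons_rV (R : realType) n :
  measurable_fun setT (@uncons_rV R n).
Proof.
apply/measurable_fun_pairP; split; first exact: measurable_coord_rV.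
apply/measurable_fun_rVP => j.
rewrite (_ : (fun _ => _) = (fun v : 'rV[R]_n.+1 => v 0 (lift ord0 j))).
  exact: measurable_coord_rV.
by apply/funext => v /=; rewrite mxE.
Qed.

Lemma cons_rV0 (R : realType) n (p : R * 'rV[R]_n) : cons_rV p 0 ord0 = p.1.
Proof.
have -> : ord0 = lshift n ord0 :> 'I_(1 + n) by exact/val_inj.
by rewrite -[LHS]/(row_mx p.1%:M p.2 0 (lshift n ord0)) row_mxEl mxE eqxx mulr1n.
Qed.

Lemma cons_rVS (R : realType) n (p : R * 'rV[R]_n) j :
  cons_rV p 0 (lift ord0 j) = p.2 0 j.
Proof.
have -> : lift ord0 j = rshift 1 j :> 'I_(1 + n) by exact/val_inj.
by rewrite -[LHS]/(row_mx p.1%:M p.2 0 (rshift 1 j)) row_mxEr.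
Qed.

Lemma cons_rVK (R : realType) n : cancel (@cons_rV R n) (@uncons_rV R n).
Proof.
move=> [x v]; rewrite /uncons_rV cons_rV0; congr pair.
by apply/rowP => j; rewrite mxE cons_rVS.
Qed.

Section lebesgue_step.
Context {R : realType} (n : nat).
Variable mu : {sigma_finite_measure set 'rV[R]_n -> \bar R}.
Local Open Scope ereal_scope.

Definition lebesgue_step : set 'rV[R]_n.+1 -> \bar R :=
  pushforward (lebesgue_measure \x mu) (@cons_rV R n).

Let step_measure : {measure set 'rV[R]_n.+1 -> \bar R} :=
  measure_function_pushforward__canonical__measure_function_Measure
    (lebesgue_measure \x mu) (@measurable_cons_rV R n).

HB.instance Definition _ := isMeasure.Build _ _ _ lebesgue_step
  (measure0 step_measure) (measure_ge0 step_measure)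
  (@measure_semi_sigma_additive _ _ _ step_measure).

Let step_sigma_finite : sigma_finite setT lebesgue_step.
Proof.
have /sigma_finiteP[F [TF ndF Foo]] := sigma_finiteT (@lebesgue_measure R).
have /sigma_finiteP[G [TG ndG Goo]] := sigma_finiteT mu.
exists (fun k => @uncons_rV R n @^-1` (F k `*` G k)).
  rewrite -preimage_bigcup (_ : \bigcup_k _ = setT) ?preimage_setT//.
  rewrite -setXTT TF TG predeqE => -[x y]; split.
    by move=> [k _ []/= ? ?]; split; exists k.
  move=> [/= [k _ Fkx] [l _ Gly]]; exists (maxn k l) => //; split.
  - by move: x Fkx; exact/subsetPset/ndF/leq_maxl.
  - by move: y Gly; exact/subsetPset/ndG/leq_maxr.
move=> k; have [mF Fk] := Foo k; have [mG Gk] := Goo k; split.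
  rewrite -[X in measurable X]setTI; apply: measurable_uncons_rV => //.
  exact: measurableX.
rewrite /lebesgue_step /pushforward -comp_preimage.
rewrite (_ : _ \o _ = id) ?preimage_id//.
  by rewrite product_measure1E// lte_mul_pinfty// ge0_fin_numE.
by apply/funext => p; exact: cons_rVK.
Qed.

HB.instance Definition _ := Measure_isSigmaFinite.Build _ _ _ lebesgue_step
  step_sigma_finite.

End lebesgue_step.

Fixpoint lebesgue_rV (R : realType) (n : nat) :
    {sigma_finite_measure set 'rV[R]_n -> \bar R} :=
  match n with
  | 0 => \d_(0 : 'rV[R]_0)
  | n'.+1 => lebesgue_step (lebesgue_rV R n')
  end.

Lemma lebesgue_rV_box (R : realType) n (A : 'I_n -> set R) :
  (forall i, measurable (A i)) ->
  lebesgue_rV R n [set v | forall i, A i (v 0 i)] =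
  (\prod_(i < n) lebesgue_measure (A i))%E.
Proof.
elim: n A => [|n IH] A mA.
  by rewrite big_ord0 /= diracE mem_set// => -[].
pose B := [set v : 'rV[R]_n | forall i, A (lift ord0 i) (v 0 i)].
have mB : measurable B.
  rewrite (_ : B = \bigcap_(i in [set: 'I_n])
    ((fun v : 'rV[R]_n => v 0 i) @^-1` A (lift ord0 i))); last first.
    by apply/seteqP; split=> v /= h i; [move=> _|]; exact: h.
  apply: fin_bigcap_measurable => // i _.
  by rewrite -[X in measurable X]setTI; exact: measurable_coord_rV.
rewrite big_ord_recl -IH// -/B -product_measure1E//=; last exact: mA.
rewrite /lebesgue_step /pushforward; congr (product_measure1 _ _ _).
apply/seteqP; split=> [[x v]|[x v]] /= h.
  split=> [|i]; first by have := h ord0; rewrite cons_rV0.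
  by have := h (lift ord0 i); rewrite cons_rVS.
case: h => h0 h i; case: (unliftP ord0 i) => [j|] ->.
  by rewrite cons_rVS; exact: h.
by rewrite cons_rV0.
Qed.

Definition locally_lipschitz (R : realType) (V W : normedModType R)
    (f : V -> W) : Prop :=
  forall x : V, exists2 A : set V, nbhs x A & [lipschitz f y | y in A].

Definition is_solution (R : realType) (n : nat) (f : 'rV[R]_n -> 'rV[R]_n)
    (x0 : 'rV[R]_n) (T : R) (x : R -> 'rV[R]_n) : Prop :=
  [/\ x 0 = x0, {within `[0, T], continuous x}
    & forall t, 0 < t < T -> is_derive t (1 : R) x (f (x t))].

(* [flow f t x0] is x(t; x0); it takes the junk value 0 when t lies outside
   the interval of existence of the solution. For f locally Lipschitz and x0
   in a compact set the solution exists on some [0, T] with T > 0 independent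
   of x0, so the limit t -> 0+ in [is_koopman_generator] never sees it. *)
Definition flow (R : realType) (n : nat) (f : 'rV[R]_n -> 'rV[R]_n)
    (t : R) (x0 : 'rV[R]_n) : 'rV[R]_n :=
  xget 0 [set y | exists2 x, is_solution f x0 t x & x t = y].

Definition koopman (R : realType) (n : nat) (f : 'rV[R]_n -> 'rV[R]_n)
    (t : R) (phi : 'rV[R]_n -> R) : 'rV[R]_n -> R :=
  fun x0 => phi (flow f t x0).

Section L2.
Context {R : realType} {n : nat}.
Variable X : set 'rV[R]_n.
Implicit Types (f : 'rV[R]_n -> 'rV[R]_n) (phi chi h : 'rV[R]_n -> R).

Definition in_L2 phi : Prop :=
  measurable_fun X phi /\
  (lebesgue_rV R n).-integrable X (fun x => (phi x ^+ 2)%:E).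

Definition L2_inner phi chi : R :=
  \int[lebesgue_rV R n]_(x in X) (phi x * chi x).

(* phi is in the domain of the generator of the Koopman semigroup on L^2(X),
   which maps it to (the class of) h. *)
Definition is_koopman_generator f phi h : Prop :=
  [/\ in_L2 phi, in_L2 h, \forall t \near 0^'+, in_L2 (koopman f t phi)
    & (\int[lebesgue_rV R n]_(x in X)
         (((koopman f t phi x - phi x) / t - h x) ^+ 2)%:E)%E
        @[t --> 0^'+] --> 0%E].

End L2.

Definition gradient (R : realType) (n : nat) (phi : 'rV[R]_n -> R)
    (x : 'rV[R]_n) : 'rV[R]_n :=
  \row_a 'D_(delta_mx 0 a) phi x.

(* The pointwise expression of the generator, <f(x), grad phi(x)>. *)
Definition lie_derivative (R : realType) (n : nat)
    (f : 'rV[R]_n -> 'rV[R]_n) (phi : 'rV[R]_n -> R) (x : 'rV[R]_n) : R :=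
  \sum_(a < n) f x 0 a * gradient phi x 0 a.

Section control.
Context {R : realType} {n nc : nat}.

(* Index ord0 is the drift; index lift ord0 j is the j-th control direction. *)
Definition control_rhs (g : 'I_nc.+1 -> 'rV[R]_n -> 'rV[R]_n)
    (ubar : 'rV[R]_nc) : 'rV[R]_n -> 'rV[R]_n :=
  fun x => g ord0 x + \sum_(j < nc) ubar 0 j *: g (lift ord0 j) x.

Definition unit_control (i : 'I_nc.+1) : 'rV[R]_nc :=
  if unlift ord0 i is Some j then delta_mx 0 j else 0.

Definition control_combination (N : nat) (L : 'I_nc.+1 -> 'M[R]_N)
    (v : 'rV[R]_nc) : 'M[R]_N :=
  L ord0 + \sum_(j < nc) v 0 j *: (L (lift ord0 j) - L ord0).

End control.

Section edmd.
Context {R : realType} {n N : nat}.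
Variable psi : 'I_N -> 'rV[R]_n -> R.

Definition gram (X : set 'rV[R]_n) : 'M[R]_N :=
  \matrix_(k, j) L2_inner X (psi k) (psi j).

Definition stiffness (X : set 'rV[R]_n) (f : 'rV[R]_n -> 'rV[R]_n) : 'M[R]_N :=
  \matrix_(k, j) L2_inner X (psi k) (lie_derivative f (psi j)).

(* Matrix, in the basis psi, of the Galerkin projection of the generator. *)
Definition galerkin (X : set 'rV[R]_n) (f : 'rV[R]_n -> 'rV[R]_n) : 'M[R]_N :=
  invmx (gram X) *m stiffness X f.

Section empirical.
Context {m : nat}.
Variable xs : 'I_m -> 'rV[R]_n.

Definition gram_hat : 'M[R]_N :=
  \matrix_(k, j) (m%:R^-1 * \sum_(l < m) psi k (xs l) * psi j (xs l)).

Definition stiffness_hat (f : 'rV[R]_n -> 'rV[R]_n) : 'M[R]_N :=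
  \matrix_(k, j)
    (m%:R^-1 * \sum_(l < m) psi k (xs l) * lie_derivative f (psi j) (xs l)).

Definition estimator (f : 'rV[R]_n -> 'rV[R]_n) : 'M[R]_N :=
  invmx gram_hat *m stiffness_hat f.

End empirical.
End edmd.

Definition frobenius_norm (R : realType) (p q : nat) (M : 'M[R]_(p, q)) : R :=
  Num.sqrt (\sum_(i < p) \sum_(j < q) M i j ^+ 2).

Section sampling.
Context {R : realType} {n : nat} {d : measure_display} {Omega : measurableType d}.
Variable P : probability Omega R.

Definition mutually_independent (m : nat) (xi : 'I_m -> Omega -> 'rV[R]_n) : Prop :=
  forall (J : {set 'I_m}) (B : 'I_m -> set 'rV[R]_n),
    (forall l, measurable (B l)) ->
    P (\bigcap_(l in [set` J]) (xi l @^-1` B l)) =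
    (\prod_(l in J) P (xi l @^-1` B l))%E.

Definition lebesgue_iid_sample (X : set 'rV[R]_n) (m : nat)
    (xi : 'I_m -> Omega -> 'rV[R]_n) : Prop :=
  [/\ forall l, measurable_fun [set: Omega] (xi l),
      forall l w, X (xi l w),
      forall l A, measurable A ->
        P (xi l @^-1` A) =
        ((fine (lebesgue_rV R n X))^-1%:E * lebesgue_rV R n (A `&` X))%E
    & mutually_independent xi].

End sampling.

(* Main.v *)
Require Import Defs.
From HB Require Import structures.
From mathcomp Require Import all_boot all_order all_algebra.
From mathcomp Require Import all_classical all_reals all_analysis.
From mathcomp Require Import measurable_realfun.
From mathcomp Require Import ring lra.
Import Order.TTheory GRing.Theory Num.Theory.
Import numFieldNormedType.Exports.
Local Open Scope classical_set_scope.
Local Open Scope ring_scope.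

(** The Galerkin matrix solves [C *m L = A], where [C] and [A] collect inner
    products over [X], and the estimator solves the same system with [C] and
    [A] replaced by sample averages.  Dividing [C] and [A] by the volume of [X]
    turns them into the expectations of these averages and leaves [L]
    unchanged.  The estimation error is then controlled in two steps.

    Statistics.  Every entry of the two matrices is the mean of an observable
    [psi k * psi j] or [psi k * lie_derivative f (psi j)].  Its second moment is
    finite: [psi k] is continuous, hence bounded on the compact [X], and the
    other factor is in L^2.  Independent samples are uncorrelated
    ([independent_covariance], through the uniqueness of product measures and
    Fubini), so the mean squared error of an average of [m] samples is at most
    the second moment divided by [m] ([sample_mean_mse]).  Summing over all
    entries and all [nc.+1] data sets and applying the Markov inequality once
    shows that all entries are simultaneously [eta]-accurate with probability
    at least [1 - S / (m * eta ^+ 2)] ([iid_samples_concentration]).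

    Perturbation.  Near an invertible [C] the solution map is Lipschitz
    ([invmx_mul_perturbation]): [eta]-accurate entries, for [eta] below a
    threshold, make the empirical Gram matrices invertible and give an error
    of at most [K * eta] on each of the matrices.  The control enters the error
    only as the coefficients of a linear combination, and these are bounded
    because [U] is; hence one constant [K], and the one event that all entries are
    accurate, serve every control and every time.

    With [eta = eps / (K + beta * eps)], which is below both [1 / beta] (the
    threshold) and [eps / K], the requirement [S / (m * eta ^+ 2) <= delta]
    becomes [m >= S * (K + beta * eps) ^+ 2 / (eps ^+ 2 * delta)], which has the
    announced order.  The volume of [X] is known to be finite and nonzero as
    soon as there is one sample, since the law of that sample has total
    mass 1. *)

Set Implicit Arguments.
Unset Strict Implicit.

(** * Perturbation of linear systems in the maximum norm *)

Section linear_algebra.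
Context {R : realType}.

Lemma ler_mx_norm_entry p q (M : 'M[R]_(p, q)) i j : `|M i j| <= `|M|.
Proof.
rewrite [leRHS]mx_normrE.
exact: (@le_bigmax _ _ _ 0 (fun ij : 'I_p * 'I_q => `|M ij.1 ij.2|) (i, j)).
Qed.

Lemma mx_norm_le p q (M : 'M[R]_(p, q)) c :
  0 <= c -> (forall i j, `|M i j| <= c) -> `|M| <= c.
Proof.
move=> c0 Mc; rewrite [leLHS]mx_normrE.
by apply/bigmax_leP; split=> // -[i j] _ /=.
Qed.

Lemma ler_mx_normM p q r (A : 'M[R]_(p, q)) (B : 'M[R]_(q, r)) :
  `|A *m B| <= q%:R * (`|A| * `|B|).
Proof.
apply: mx_norm_le => [|i j]; first by rewrite !mulr_ge0.
rewrite mxE (le_trans (ler_norm_sum _ _ _))//.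
rewrite (@le_trans _ _ (\sum_(k < q) `|A| * `|B|))//.
  by apply: ler_sum => k _; rewrite normrM ler_pM// ler_mx_norm_entry.
by rewrite sumr_const card_ord mulr_natl.
Qed.

Lemma frobenius_norm_le N (M : 'M[R]_N) : frobenius_norm M <= N%:R * `|M|.
Proof.
rewrite -[leRHS]ger0_norm ?mulr_ge0//.
rewrite -sqrtr_sqr /frobenius_norm ler_wsqrtr//.
rewrite exprMn -natrX expnS expn1.
rewrite (@le_trans _ _ (\sum_(i < N) \sum_(j < N) `|M| ^+ 2))//.
  apply: ler_sum => i _; apply: ler_sum => j _.
  by rewrite -[leLHS]real_normK ?num_real// ler_sqr ?nnegrE// ler_mx_norm_entry.
by rewrite !sumr_const card_ord -mulrnA mulr_natl.
Qed.

Lemma control_combinationB nc N (L L' : 'I_nc.+1 -> 'M[R]_N) v :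
  control_combination L v - control_combination L' v =
  control_combination (fun i => L i - L' i) v.
Proof.
rewrite /control_combination opprD addrACA -sumrB; congr (_ + _).
apply: eq_bigr => j _; rewrite -scalerBr; congr (_ *: _).
by apply/matrixP => i k; rewrite !mxE; ring.
Qed.

(** Each of the [nc] directions contributes a difference of two matrices, hence
    the factor 2. *)
Lemma control_combination_le nc N (D : 'I_nc.+1 -> 'M[R]_N) v (b c : R) :
  `|v| <= b -> (forall i, `|D i| <= c) ->
  `|control_combination D v| <= (1 + nc%:R * (b * 2)) * c.
Proof.
move=> vb Dc; have b0 : 0 <= b by exact: le_trans vb.
have c0 : 0 <= c by exact: le_trans (Dc ord0).
rewrite mulrDl mul1r (le_trans (ler_normD _ _))// lerD//.
rewrite (le_trans (ler_norm_sum _ _ _))//.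
rewrite (@le_trans _ _ (\sum_(j < nc) b * (2 * c)))//.
  apply: ler_sum => j _; rewrite normrZ ler_pM//.
    by rewrite (le_trans _ vb)// ler_mx_norm_entry.
  by rewrite (le_trans (ler_normB _ _))// mulr_natl mulr2n lerD.
by rewrite sumr_const card_ord -[leLHS]mulr_natl !mulrA.
Qed.

(** A vector in the left kernel of [C + E] satisfies [v = - v *m E *m invmx C],
    and the smallness condition makes the right-hand side a strict
    contraction. *)
Lemma unitmx_perturbation N (C E : 'M[R]_N) (eta : R) :
  C \in unitmx -> `|E| <= eta -> N%:R ^+ 2 * `|invmx C| * eta <= 2^-1 ->
  C + E \in unitmx.
Proof.
move=> Cu Ee small; rewrite -row_free_unit -kermx_eq0.
apply/eqP/row_matrixP => i; rewrite row0.
set v := row i _.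
have : v *m (C + E) = 0 by rewrite /v -row_mul mulmx_ker row0.
rewrite mulmxDr => /eqP; rewrite addr_eq0 => /eqP vC.
have vE : v = - (v *m E) *m invmx C by rewrite -vC mulmxK.
apply/eqP; rewrite -normr_eq0 eq_le normr_ge0 andbT.
suff : `|v| <= 2^-1 * `|v|.
  by have := normr_ge0 v; lra.
rewrite {1}vE (le_trans (ler_mx_normM _ _))// normrN.
have h := ler_mx_normM v E.
apply: (@le_trans _ _ (N%:R * ((N%:R * (`|v| * eta)) * `|invmx C|))).
  rewrite ler_wpM2l// ler_wpM2r// (le_trans h)// ler_wpM2l// ler_wpM2l//.
rewrite (_ : _ * _ = (N%:R ^+ 2 * `|invmx C| * eta) * `|v|); last by ring.
by rewrite ler_wpM2r.
Qed.

(** The error [Z] is a fixed point of an affine map whose linear part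
    [invmx C *m (C - C') *m Z] has norm at most [1 / 2]; absorbing it into the
    left-hand side doubles the constant and avoids any estimate of
    [invmx C']. *)
Lemma invmx_mul_perturbation N (C A C' A' : 'M[R]_N) (eta : R) :
  C \in unitmx -> `|C' - C| <= eta -> `|A' - A| <= eta ->
  N%:R ^+ 2 * `|invmx C| * eta <= 2^-1 ->
  C' \in unitmx /\
  `|invmx C *m A - invmx C' *m A'| <=
    2 * N%:R * `|invmx C| * (1 + N%:R * `|invmx C *m A|) * eta.
Proof.
move=> Cu Ce Ae small.
have C'u : C' \in unitmx.
  by rewrite -[C'](subrK C) addrC (unitmx_perturbation (eta := eta)).
split=> //; set G := invmx C *m A; set Z := G - invmx C' *m A'.
have eta0 : 0 <= eta by exact: le_trans Ce.
have ZE : Z = - (invmx C *m ((A' - A) - (C' - C) *m G - (C - C') *m Z)).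
  apply: (can_inj (mulKmx Cu)).
  rewrite mulmxN mulmxA mulmxV// mul1mx.
  have CG : C *m G = A by rewrite mulKVmx.
  have C'Z : C' *m Z = C' *m G - A' by rewrite mulmxBr mulKVmx.
  rewrite !mulmxBl C'Z CG.
  move: (C' *m G) (C *m Z) => x y.
  by apply/matrixP => i j; rewrite !mxE; ring.
have ZG := ler_mx_normM (C' - C) G.
have ZZ := ler_mx_normM (C - C') Z.
set k := `|invmx C| in small *.
have hZ : `|Z| <=
    N%:R * (k * (eta + N%:R * (eta * `|G|) + N%:R * (eta * `|Z|))).
  rewrite {1}ZE normrN (le_trans (ler_mx_normM _ _))// ler_wpM2l// ler_wpM2l//.
  rewrite (le_trans (ler_normB _ _))// lerD//.
    rewrite (le_trans (ler_normB _ _))// lerD// (le_trans ZG)//.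
    by rewrite ler_wpM2l// ler_wpM2r.
  by rewrite (le_trans ZZ)// ler_wpM2l// ler_wpM2r// distrC.
have hs : N%:R ^+ 2 * k * eta * `|Z| <= 2^-1 * `|Z| by rewrite ler_wpM2r.
move: hZ hs; rewrite -/k; set n := N%:R; lra.
Qed.

End linear_algebra.

(** * Measurability of compact sets and of matrix operations *)

Section measurability.
Context {R : realType}.

Lemma measurable_ball_rV n (c : 'rV[R]_n) (e : R) : measurable (ball c e).
Proof.
have [e0|e0] := leP e 0.
  rewrite (_ : ball c e = set0) //; apply/seteqP; split=> // x.
  rewrite mx_norm_ball /ball_/= => /(le_lt_trans (normr_ge0 _)).
  by rewrite ltNge e0.
rewrite (_ : ball c e = \bigcap_(j in [set: 'I_n])
    ((fun v : 'rV[R]_n => v 0 j) @^-1` ball (c 0 j) e)); last first.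
  apply/seteqP; split=> x /=; first by case=> _ xe j _; exact: xe.
  by move=> xe; split=> // i j; rewrite ord1; exact: xe.
apply: fin_bigcap_measurable => // j _.
rewrite -[X in measurable X]setTI; apply: measurable_coord_rV => //.
exact: measurable_ball.
Qed.

(** The sigma-algebra is generated by the coordinates, not by the open sets,
    but it contains all boxes.  A compact set is the intersection over [k] of
    finite unions of balls of radius [1 / (k + 1)] centred in it, and balls of
    the maximum norm are boxes. *)
Lemma compact_measurable_rV n (A : set 'rV[R]_n) : compact A -> measurable A.
Proof.
move=> cA; have clA : closed A.
  by apply: compact_closed => //; exact: norm_hausdorff.
have fin k : exists D : set 'rV[R]_n,
    [/\ finite_set D, D `<=` A & A `<=` \bigcup_(c in D) ball c k.+1%:R^-1].
  move: (cA); rewrite compact_cover => /(_ _ A (fun c => ball c k.+1%:R^-1)).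
  case=> [c _||D DA AD]; first exact: ball_open.
    by move=> x Ax; exists x => //; exact: ballxx.
  eexists; split; last exact: AD; first exact: finite_fset.
  by move=> x /DA; rewrite inE.
have [D DP] := choice fin.
rewrite (_ : A = \bigcap_k \bigcup_(c in D k) ball c k.+1%:R^-1).
  apply: bigcapT_measurable => k; have [finD _ _] := DP k.
  by apply: fin_bigcup_measurable => // c _; exact: measurable_ball_rV.
apply/seteqP; split=> [x Ax k _|x xD]; first by have [_ _] := DP k; exact.
suff : closure A x by rewrite -(closure_id A).1.
move=> B /nbhs_ballP[e /= e0 eB].
have [k ke] := filter_ex (near_infty_natSinv_lt (PosNum e0)).
have [c Dc xc] := xD k I; have [_ /(_ _ Dc) Ac _] := DP k.
exists c; split=> //; apply: eB; apply: ball_sym.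
by apply: le_ball xc; exact: ltW.
Qed.

(** Inversion is continuous on the open set of nonzero reals. *)
Lemma measurable_invr : measurable_fun [set: R] (fun x : R => x^-1).
Proof.
rewrite -(setUv [set (0 : R)]); apply/measurable_funU => //.
  exact: measurableC.
split; first exact: measurable_fun_set1.
apply: open_continuous_measurable_fun.
  by apply: closed_openC.
by move=> x /[!inE]/= /eqP x0; exact: inv_continuous.
Qed.

Context d (T : measurableType d).

(** Entrywise measurability, which spares a sigma-algebra on rectangular
    matrices. *)
Definition measurable_mx p q (M : T -> 'M[R]_(p, q)) :=
  forall i j, measurable_fun [set: T] (fun w => M w i j).

Lemma measurable_mulmx p q r (A : T -> 'M[R]_(p, q)) (B : T -> 'M[R]_(q, r)) :
  measurable_mx A -> measurable_mx B -> measurable_mx (fun w => A w *m B w).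
Proof.
move=> mA mB i j; under eq_fun do rewrite mxE.
by apply: measurable_sum => k; exact: measurable_funM.
Qed.

Lemma measurable_det p (M : T -> 'M[R]_p) :
  measurable_mx M -> measurable_fun [set: T] (fun w => \det (M w)).
Proof.
move=> mM; apply: measurable_sum => s; apply: measurable_funM => //.
by apply: measurable_prod => i _; exact: mM.
Qed.

Lemma measurable_unitmx p (M : T -> 'M[R]_p) :
  measurable_mx M -> measurable_fun [set: T] (fun w => M w \in unitmx).
Proof.
move=> mM; under eq_fun do rewrite unitmxE unitfE.
apply: measurable_neg; apply: measurable_fun_eqr => //.
exact: measurable_det.
Qed.

(** On the measurable set of units the entries are given by the cofactor
    formula; elsewhere [invmx] is the identity function. *)
Lemma measurable_invmx p (M : T -> 'M[R]_p) :
  measurable_mx M -> measurable_mx (fun w => invmx (M w)).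
Proof.
move=> mM i j.
rewrite (_ : (fun w => _) = fun w => if M w \in unitmx
    then (\det (M w))^-1 * cofactor (M w) j i else M w i j); last first.
  by apply/funext => w; rewrite /invmx; case: ifP; rewrite ?mxE.
apply: measurable_fun_ifT => //; first exact: measurable_unitmx.
apply: measurable_funM.
  by apply: (measurableT_comp measurable_invr); exact: measurable_det.
apply: measurable_funM => //; apply: measurable_det => k l.
by under eq_fun do rewrite !mxE; exact: mM.
Qed.

Lemma measurable_frobenius_le p q (M : T -> 'M[R]_(p, q)) (e : R) : 0 <= e ->
  measurable_mx M -> measurable [set w | frobenius_norm (M w) <= e].
Proof.
move=> e0 mM.
have frobE w : (frobenius_norm (M w) <= e) =
    (\sum_i \sum_j M w i j ^+ 2 <= e ^+ 2).
  rewrite /frobenius_norm -[in LHS](ger0_norm e0) -sqrtr_sqr.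
  by rewrite ler_sqrt ?sqr_ge0.
under eq_set do rewrite frobE.
rewrite -[X in measurable X]setTI.
apply: measurable_fun_ler => //.
apply: measurable_sum => i; apply: measurable_sum => j.
exact: measurable_funX.
Qed.

End measurability.

(** * Change of variables and uncorrelated averages *)

Section change_of_variables.
Local Open Scope ereal_scope.
Context {R : realType} d d' (T : measurableType d) (S : measurableType d').
Variables (P : {measure set T -> \bar R}) (mu : {measure set S -> \bar R}).
Variables (X : set S) (xi : T -> S) (c : {nonneg R}).
Hypotheses (mX : measurable X) (mxi : measurable_fun [set: T] xi).
Hypothesis xiX : forall w, X (xi w).
Hypothesis law : forall A, measurable A ->
  P (xi @^-1` A) = c%:num%:E * mu (A `&` X).

(** The push-forward of [P] and the scaled measure [mu] agree on the measurable
    subsets of [X], which is all that an integral over [X] depends on; extending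
    [h] by 0 outside [X] makes it measurable on the whole space. *)
Lemma ge0_integral_scaled_law (h : S -> \bar R) :
  measurable_fun X h -> (forall x, X x -> 0 <= h x) ->
  \int[P]_w h (xi w) = c%:num%:E * \int[mu]_(x in X) h x.
Proof.
move=> mh h0.
have mhX : measurable_fun [set: S] (h \_ X).
  by apply: (measurable_restrictT _ _).1.
have xiXT : xi @^-1` X = setT by apply/seteqP; split=> // w _; exact: xiX.
transitivity (\int[pushforward P xi]_(x in X) (h \_ X) x).
  rewrite ge0_integral_pushforward//.
  - rewrite xiXT; apply: eq_integral => w _ /=.
    by rewrite patchE mem_set//.
  - exact: measurable_funTS.
  - by move=> x xX; rewrite patchE xX h0//; exact: set_mem.
rewrite [LHS](eq_measure_integral (mscale c mu)); last first.
  by move=> A mA AX; rewrite /= /pushforward law// (setIidl AX).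
rewrite ge0_integral_mscale//; last 2 first.
- exact: measurable_funTS.
- by move=> x Xx; rewrite patchE mem_set//=; exact: h0.
by congr (_ * _); apply: eq_integral => x xX; rewrite patchE xX.
Qed.

Lemma integrable_scaled_law (h : S -> \bar R) :
  mu.-integrable X h -> P.-integrable [set: T] (h \o xi).
Proof.
move=> /integrableP[mh hoo]; apply/integrableP; split.
  by apply: (measurable_comp mX) => // _ [w _ <-]; exact: xiX.
rewrite (ge0_integral_scaled_law (h := abse \o h))//.
- by rewrite lte_mul_pinfty ?lee_fin.
- exact: measurableT_comp.
- by move=> x _; exact: abse_ge0.
Qed.

Lemma integral_scaled_law (h : S -> \bar R) : mu.-integrable X h ->
  \int[P]_w h (xi w) = c%:num%:E * \int[mu]_(x in X) h x.
Proof.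
move=> ih; have mh := measurable_int _ ih.
rewrite [in LHS]integralE [in RHS]integralE.
have pfin := integrable_fin_num mX (integrable_funepos mX ih).
have nfin := integrable_fin_num mX (integrable_funeneg mX ih).
rewrite muleBr ?fin_num_adde_defr ?fin_numN//.
rewrite -!ge0_integral_scaled_law//.
- under eq_integral do rewrite (funepos_comp h xi)/=.
  by under [X in _ - X]eq_integral do rewrite (funeneg_comp h xi)/=.
- exact: measurable_funeneg.
- exact: measurable_funepos.
Qed.

End change_of_variables.

Section uncorrelated.
Local Open Scope ereal_scope.
Context {R : realType} d (T : measurableType d) (P : probability T R).

(** The product rule on rectangles determines the joint law as the product of
    the two marginal laws, and Fubini factors the expectation of the product.
    Square integrability is what makes the product integrable. *)
Lemma independent_covariance (Y Z : T -> R) :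
  Y \in Lfun P 2%:E -> Z \in Lfun P 2%:E ->
  (forall A B, measurable A -> measurable B ->
    P (Y @^-1` A `&` Z @^-1` B) = P (Y @^-1` A) * P (Z @^-1` B)) ->
  covariance P Y Z = 0.
Proof.
move=> Y2 Z2 YZ.
have Pfin : P setT \is a fin_num by exact: fin_num_measure.
have Y1 := Lfun_subset12 Pfin Y2; have Z1 := Lfun_subset12 Pfin Z2.
have YZ1 := Lfun2_mul_Lfun1 Y2 Z2.
have mY : measurable_fun setT Y by have /sub_Lfun_mfun := Y2; rewrite inE.
have mZ : measurable_fun setT Z by have /sub_Lfun_mfun := Z2; rewrite inE.
pose Y' : {mfun T >-> R} := HB.pack Y (isMeasurableFun.Build _ _ _ _ _ mY).
pose Z' : {mfun T >-> R} := HB.pack Z (isMeasurableFun.Build _ _ _ _ _ mZ).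
have mW : measurable_fun setT (fun w => (Y w, Z w)).
  exact: measurable_fun_pair.
pose W : {mfun T >-> (R * R)%type} :=
  HB.pack (fun w => (Y w, Z w)) (isMeasurableFun.Build _ _ _ _ _ mW).
suff EYZ : 'E_P[(Y * Z)%R] = 'E_P[Y] * 'E_P[Z].
  by rewrite covarianceE// EYZ subee// fin_numM ?expectation_fin_num.
pose f (z : (R * R)%type) := (z.1 * z.2)%R%:E.
have mf : measurable_fun setT f.
  by apply/measurable_EFinP; apply: measurable_funM => //.
have prodE A : measurable A ->
    (distribution P Y' \x distribution P Z') A = distribution P W A.
  by apply: product_measure_unique => B C mB mC; rewrite /= -YZ.
have iW : P.-integrable setT (f \o W) by exact/Lfun1_integrable.
have iY : P.-integrable setT (EFin \o Y) by exact/Lfun1_integrable.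
have iZ : P.-integrable setT (EFin \o Z) by exact/Lfun1_integrable.
have idW : (distribution P W).-integrable setT f.
  exact: integrable_pushforward.
have ifp : (distribution P Y' \x distribution P Z').-integrable setT f.
  move: idW => /integrableP[_ foo]; apply/integrableP; split => //.
  by rewrite (eq_measure_integral (distribution P W))// => A mA _; exact: prodE.
have iZ' : (distribution P Z').-integrable setT EFin.
  by apply: integrable_pushforward => //; exact/measurable_EFinP.
have iY' : (distribution P Y').-integrable setT EFin.
  by apply: integrable_pushforward => //; exact/measurable_EFinP.
rewrite unlock.
transitivity (\int[distribution P W]_z f z).
  by rewrite integral_distribution.
rewrite -(eq_measure_integral _ (fun A mA _ => prodE A mA)).
rewrite -integral12_prod_meas1//= /fubini_F/=.
under eq_integral => x _.
  under eq_integral do rewrite /f/= EFinM.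
  rewrite integralZl//.
  over.
have Zfin := integrable_fin_num measurableT iZ'.
rewrite -(fineK Zfin) integralZr// fineK//; congr (_ * _).
  by rewrite integral_distribution//; exact/measurable_EFinP.
by rewrite integral_distribution//; exact/measurable_EFinP.
Qed.

Section sum.
Variables (I : eqType) (Y : I -> T -> R) (mu s : R).
Hypothesis Y2 : forall l, Y l \in Lfun P 2%:E.
Hypothesis EY : forall l, 'E_P[Y l] = mu%:E.
Hypothesis EY2 : forall l, 'E_P[(Y l ^+ 2)%R] <= s%:E.
Hypothesis cov0 : forall l k, l != k -> covariance P (Y l) (Y k) = 0.

(** The statements are proved together by induction: the variance of a sum needs
    the covariance of the partial sum with the next term, and that vanishes
    because the index of the next term has not occurred yet. *)
Lemma variance_uncorrelated_sum (r : seq I) : uniq r ->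
  let S w := (\sum_(l <- r) Y l w)%R in
  [/\ S \in Lfun P 2%:E, 'E_P[S] = ((size r)%:R * mu)%:E,
      variance P S <= ((size r)%:R * s)%:E
    & forall k, k \notin r -> covariance P S (Y k) = 0].
Proof.
have Pfin : P setT \is a fin_num by exact: fin_num_measure.
elim: r => [_|l r ih /=/andP[lr ur]].
  rewrite /= (_ : (fun=> _) = cst 0%R); last first.
    by apply/funext => w; rewrite big_nil.
  split; first exact: Lfun_cst.
  - by rewrite expectation_cst mul0r.
  - by rewrite variance_cst mul0r.
  - by move=> k _; rewrite covariance_cst_l.
have [S2 ES VS covS] := ih ur.
rewrite (_ : (fun=> _) = Y l \+ (fun w => \sum_(l <- r) Y l w))%R; last first.
  by apply/funext => w; rewrite big_cons.
set S := (fun w => _) in S2 ES VS covS *.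
split.
- by rewrite rpredD// lee1n.
- rewrite expectationD; [|exact: (Lfun_subset12 Pfin)..].
  by rewrite EY ES -EFinD mulrSr mulrDl mul1r addrC.
- rewrite varianceD// covarianceC covS// mule0 adde0.
  rewrite mulrSr mulrDl mul1r addrC EFinD leeD//.
  rewrite varianceE// (le_trans _ (EY2 l))// EY -[leRHS]adde0 leeD2l//.
  by rewrite -EFin_expe -EFinN lee_fin oppr_le0 sqr_ge0.
- move=> k; rewrite inE negb_or => /andP[kl kr].
  by rewrite covarianceDl// covS// adde0 cov0// eq_sym.
Qed.

End sum.

(** The mean squared error is the variance of the average, since the average is
    unbiased, and variances are bounded by second moments. *)
Lemma sample_mean_mse m (Y : 'I_m -> T -> R) (mu s : R) : (0 < m)%N ->
  (forall l, Y l \in Lfun P 2%:E) -> (forall l, 'E_P[Y l] = mu%:E) ->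
  (forall l, 'E_P[(Y l ^+ 2)%R] <= s%:E) ->
  (forall l k, l != k -> covariance P (Y l) (Y k) = 0) ->
  \int[P]_w ((m%:R^-1 * (\sum_(l < m) Y l w) - mu) ^+ 2)%:E <= (s / m%:R)%:E.
Proof.
move=> m0 Y2 EY EY2 cov0.
have mn0 : (m%:R != 0 :> R)%R by rewrite pnatr_eq0 -lt0n.
have Pfin : P setT \is a fin_num by exact: fin_num_measure.
have [] := variance_uncorrelated_sum Y2 EY EY2 cov0 (index_enum_uniq 'I_m).
rewrite /index_enum -enumT size_enum_ord.
set S := (fun w => _) => S2 ES VS _.
rewrite (_ : \int[P]_w _ = variance P (m%:R^-1 \o* S)%R); last first.
  rewrite /variance covariance.unlock expectationZl ?(Lfun_subset12 Pfin)//.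
  rewrite ES -EFinM/= mulKf// expectation.unlock.
  by apply: eq_integral => w _; rewrite expr2 mulrC [(_^-1 * _)%R]mulrC.
rewrite varianceZ//.
rewrite (@le_trans _ _ ((m%:R^-1 ^+ 2)%:E * (m%:R * s)%:E))//.
  by rewrite lee_wpmul2l// lee_fin sqr_ge0.
by rewrite -EFinM lee_fin expr2 -mulrA mulKf// mulrC.
Qed.

End uncorrelated.

(** * Concentration of independent uniform samples *)

Section sampling.
Context {R : realType} {n : nat} d (T : measurableType d).
Variable P : probability T R.
Local Notation leb := (lebesgue_rV R n).

Lemma sqr_integrable_Lfun2 (f : T -> R) : measurable_fun [set: T] f ->
  P.-integrable [set: T] (fun x => (f x ^+ 2)%:E) -> f \in Lfun P 2%:E.
Proof.
move=> mf if2; rewrite inE; apply/andP; split; rewrite inE//=.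
rewrite /finite_norm unlock poweR_lty//.
move: (integrable_lty measurableT if2); congr (_ < _)%E.
apply: eq_integral => x _.
by rewrite /= powR_mulrn// -normrX ger0_norm ?sqr_ge0.
Qed.

Section iid.
Variables (X : set 'rV[R]_n) (m : nat) (xi : 'I_m -> T -> 'rV[R]_n).
Hypotheses (mX : measurable X) (iid : lebesgue_iid_sample P X xi).
Hypothesis m0 : (0 < m)%N.

(** Both degenerate cases, a null set and a set of infinite volume, have
    [fine (leb X) = 0], and then the law of a sample would be the zero
    measure. *)
Lemma iid_sample_volume_neq0 : fine (leb X) != 0.
Proof.
have [_ _ law _] := iid; have := law (Ordinal m0) setT measurableT.
rewrite preimage_setT probability_setT setTI.
by apply: contra_eq_neq => ->; rewrite invr0 mul0e eqe oner_neq0.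
Qed.

(** Independence of the samples passes to the compositions with [h].  As [h] is
    measurable on [X] only, preimages are first intersected with [X], where the
    samples live. *)
Lemma iid_sample_covariance (h : 'rV[R]_n -> R) l k :
  measurable_fun X h -> (forall l, h \o xi l \in Lfun P 2%:E) -> l != k ->
  covariance P (h \o xi l) (h \o xi k) = 0%E.
Proof.
move=> mh h2 lk; have [mxi xiX _ indep] := iid.
apply: independent_covariance => // A B mA mB.
(* Only the entries l and k of C are used. *)
pose C j := if j == l then X `&` h @^-1` A else X `&` h @^-1` B.
have mC j : measurable (C j) by rewrite /C; case: ifP => _; exact: mh.
have xiC j (D : set R) : (h \o xi j) @^-1` D = xi j @^-1` (X `&` h @^-1` D).
  by apply/seteqP; split=> w /=; [move=> ?; split=> //; exact: xiX | case].
have := indep [set l; k]%SET C mC.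
rewrite big_setU1 ?inE// big_set1 /C eqxx eq_sym (negbTE lk) !xiC => <-.
congr (P _); apply/seteqP; split=> w /=.
  move=> [wl wk] j /=; rewrite !inE => /orP[]/eqP->; first by rewrite eqxx.
  by rewrite eq_sym (negbTE lk).
move=> wC; split; first by have := wC l; rewrite /= !inE !eqxx; exact.
by have := wC k; rewrite /= !inE eqxx orbT [k == l]eq_sym (negbTE lk); exact.
Qed.

Lemma iid_sample_mean_mse (h : 'rV[R]_n -> R) :
  leb.-integrable X (EFin \o h) ->
  leb.-integrable X (fun x => (h x ^+ 2)%:E) ->
  (\int[P]_w ((m%:R^-1 * (\sum_(l < m) h (xi l w)) -
     (fine (leb X))^-1 * \int[leb]_(x in X) h x) ^+ 2)%:E <=
  ((fine (leb X))^-1 * \int[leb]_(x in X) (h x ^+ 2) / m%:R)%:E)%E.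
Proof.
move=> ih ih2; have [mxi xiX law _] := iid.
have v0 : 0 <= (fine (leb X))^-1 by rewrite invr_ge0 fine_ge0.
have mh : measurable_fun X h.
  by apply/measurable_EFinP; exact: (measurable_int _ ih).
have law' l A : measurable A ->
    P (xi l @^-1` A) = ((NngNum v0)%:num%:E * leb (A `&` X))%E by exact: law.
have h2 l : h \o xi l \in Lfun P 2%:E.
  apply: sqr_integrable_Lfun2.
    by apply: (measurable_comp mX) => // _ [w _ <-]; exact: xiX.
  exact: (integrable_scaled_law mX (mxi l) (xiX l) (law' l) ih2).
apply: sample_mean_mse => //.
- move=> l; rewrite unlock /=.
  rewrite (integral_scaled_law mX (mxi l) (xiX l) (law' l) ih).
  by rewrite /Rintegral EFinM fineK//; exact: integrable_fin_num.
- move=> l; rewrite unlock /=.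
  rewrite (integral_scaled_law mX (mxi l) (xiX l) (law' l) ih2).
  by rewrite /Rintegral EFinM fineK//; exact: integrable_fin_num.
- by move=> l k lk; exact: iid_sample_covariance.
Qed.

End iid.

(** Several data sets [xi i] enter, with an arbitrary joint law; [h p] is
    averaged over the data set [c p].  Bounding the sum of all squared
    deviations with one Markov inequality gives a simultaneous statement.
    Monotonicity of [P] requires measurability of the event [E], not only that
    it contains all outcomes with small deviations. *)
Lemma iid_samples_concentration (q : nat) (I : finType) (c : I -> 'I_q)
    (X : set 'rV[R]_n) m (xi : 'I_q -> 'I_m -> T -> 'rV[R]_n)
    (h : I -> 'rV[R]_n -> R) (eta : R) (E : set T) :
  measurable X -> (forall i, lebesgue_iid_sample P X (xi i)) -> (0 < m)%N ->
  (forall p, leb.-integrable X (EFin \o h p)) ->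
  (forall p, leb.-integrable X (fun x => (h p x ^+ 2)%:E)) ->
  0 < eta -> measurable E ->
  (forall w, (forall p, `|m%:R^-1 * (\sum_(l < m) h p (xi (c p) l w)) -
     (fine (leb X))^-1 * \int[leb]_(x in X) h p x| <= eta) -> E w) ->
  (P E >= (1 - (\sum_p (fine (leb X))^-1 * \int[leb]_(x in X) (h p x ^+ 2)) /
              (m%:R * eta ^+ 2))%:E)%E.
Proof.
move=> mX iid m0 ih ih2 eta0 mE devE.
pose dev p w := m%:R^-1 * (\sum_(l < m) h p (xi (c p) l w)) -
     (fine (leb X))^-1 * \int[leb]_(x in X) h p x.
pose Q w := \sum_p dev p w ^+ 2.
have mdev p : measurable_fun [set: T] (dev p).
  apply: measurable_funB => //; apply: measurable_funM => //.
  apply: measurable_sum => l; have [mxi xiX _ _] := iid (c p).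
  apply: (measurable_comp mX) => //; first by move=> _ [w _ <-]; exact: xiX.
  by apply/measurable_EFinP; exact: (measurable_int _ (ih p)).
have mQ : measurable_fun [set: T] Q.
  by apply: measurable_sum => p; exact: measurable_funX.
have Q0 w : 0 <= Q w by apply: sumr_ge0 => p _; exact: sqr_ge0.
set s := \sum_p _.
have EQ : (\int[P]_w (Q w)%:E <= (s / m%:R)%:E)%E.
  under eq_integral do rewrite -sumEFin.
  rewrite ge0_integral_sum//; last 2 first.
  - by move=> p; apply/measurable_EFinP; exact: measurable_funX.
  - by move=> p w _; rewrite lee_fin sqr_ge0.
  rewrite /s mulr_suml -sumEFin; apply: lee_sum => p _.
  exact: iid_sample_mean_mse.
have eta20 : 0 < eta ^+ 2 by rewrite exprn_gt0.
pose Qm : {mfun T >-> R} := HB.pack Q (isMeasurableFun.Build _ _ _ _ _ mQ).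
have := @markov _ _ _ P Qm id (eta ^+ 2) eta20 (@measurable_id _ _ _)
  (fun r r0 => r0) (fun x y _ _ xy => xy).
(* The Markov inequality is stated with an absolute value, which the
   nonnegative Q absorbs. *)
have -> : [set x | (eta ^+ 2)%:E <= `|(Qm x)%:E|]%E = [set w | eta ^+ 2 <= Q w].
  by apply/seteqP; split=> w /=; rewrite lee_fin ger0_norm.
set B := [set _ | _] => PB.
have mB : measurable B.
  by rewrite -[X in measurable X]setTI; exact: measurable_fun_ler.
have {}PB : (P B <= (s / (m%:R * eta ^+ 2))%:E)%E.
  rewrite invfM mulrA EFinM lee_pdivlMr// muleC (le_trans PB)//.
  apply: le_trans EQ; rewrite unlock le_eqVlt; apply/orP; left; apply/eqP.
  by apply: eq_integral => w _ /=; rewrite ger0_norm.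
have BE : ~` B `<=` E.
  move=> w /negP; rewrite -ltNge => Qw; apply: devE => p.
  rewrite -(ger0_norm (ltW eta0)) -ler_sqr ?nnegrE// !real_normK ?num_real//.
  rewrite (le_trans _ (ltW Qw))// /Q (bigD1 p)//= lerDl sumr_ge0// => j _.
  exact: sqr_ge0.
have PBE : (P (~` B) <= P E)%E by rewrite le_measure ?inE//; exact: measurableC.
apply: le_trans PBE.
by rewrite probability_setC// EFinB leeB.
Qed.

End sampling.

(** * Data-based Galerkin matrices *)

Section observables.
Context {R : realType} {n : nat}.
Local Notation leb := (lebesgue_rV R n).
Implicit Types (X : set 'rV[R]_n) (a b : 'rV[R]_n -> R).

Lemma differentiable_bounded_on_compact X a : compact X ->
  (forall x, X x -> differentiable a x) ->
  exists B, forall x, X x -> `|a x| <= B.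
Proof.
move=> cX da.
have /compact_bounded[M [_ aM]] : compact (a @` X).
  apply: continuous_compact => //.
  apply: continuous_in_subspaceT => x /set_mem Xx.
  exact/differentiable_continuous/da.
exists (M + 1) => x Xx; apply: (aM (M + 1)); first by rewrite ltrDl.
by exists x.
Qed.

(** From [2 * |a b| <= a ^+ 2 + b ^+ 2]. *)
Lemma integrable_L2_mul X a b : measurable X -> in_L2 X a -> in_L2 X b ->
  leb.-integrable X (EFin \o (fun x => a x * b x)).
Proof.
move=> mX [ma ia] [mb ib].
apply: (le_integrable mX _ _ (integrableD mX ia ib)).
  by apply/measurable_EFinP; exact: measurable_funM.
move=> x _ /=; rewrite lee_fin normrM [leRHS]ger0_norm ?addr_ge0 ?sqr_ge0//.
rewrite -[a x ^+ 2]real_normK ?num_real// -[b x ^+ 2]real_normK ?num_real//.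
by have := sqr_ge0 (`|a x| - `|b x|); nra.
Qed.

Lemma integrable_bounded_L2_mul_sqr X a b B : measurable X ->
  measurable_fun X a -> (forall x, X x -> `|a x| <= B) -> in_L2 X b ->
  leb.-integrable X (fun x => ((a x * b x) ^+ 2)%:E).
Proof.
move=> mX ma aB [mb ib].
apply: (le_integrable mX _ _ (integrableZl mX (B ^+ 2) ib)).
  by apply/measurable_EFinP; apply: measurable_funX; exact: measurable_funM.
move=> x Xx /=.
rewrite lee_fin -[B ^+ 2 * _]exprMn !ger0_norm ?sqr_ge0// exprMn.
have aBx := aB x Xx; have B0 : 0 <= B by exact: le_trans aBx.
rewrite exprMn ler_wpM2r ?sqr_ge0// -[leLHS]real_normK ?num_real//.
by rewrite ler_sqr ?nnegrE.
Qed.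

End observables.

Section edmd.
Context {R : realType} {n nc N : nat}.
Variables (psi : 'I_N -> 'rV[R]_n -> R) (X : set 'rV[R]_n).
Variable f : 'I_nc.+1 -> 'rV[R]_n -> 'rV[R]_n.
Local Notation leb := (lebesgue_rV R n).

(** All the scalar observables whose averages form the matrices, as one finite
    family: [(i, k, j, false)] is the entry [(k, j)] of the Gram matrix of the
    data set [i], and [(i, k, j, true)] is that of its stiffness matrix. *)
Definition edmd_moment (p : 'I_nc.+1 * 'I_N * 'I_N * bool) (x : 'rV[R]_n) : R :=
  psi p.1.1.2 x *
  (if p.2 then lie_derivative (f p.1.1.1) (psi p.1.2) x else psi p.1.2 x).

Definition edmd_second_moment : R :=
  \sum_p (fine (leb X))^-1 * \int[leb]_(x in X) (edmd_moment p x ^+ 2).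

Definition edmd_event m (xs : 'I_nc.+1 -> 'I_m -> 'rV[R]_n) v eps : Prop :=
  (forall i, gram_hat psi (xs i) \in unitmx) /\
  frobenius_norm (control_combination (fun i => galerkin psi X (f i)) v -
    control_combination (fun i => estimator psi (xs i) (f i)) v) <= eps.

(** The Gram matrix is divided by the volume because that is the expectation of
    the empirical one. *)
Definition normalized_gram_inv_norm : R :=
  `|invmx ((fine (leb X))^-1 *: gram psi X)|.

(** Lipschitz constant of the error in the accuracy of the averages, for
    controls bounded by [b]: from right to left, the constant of the perturbed
    linear system (a sum over [i] dominates each Galerkin matrix), that of the
    control combination, and the comparison of norms. *)
Definition edmd_lipschitz (b : R) : R :=
  N%:R * ((1 + nc%:R * (b * 2)) * (2 * N%:R * normalized_gram_inv_norm *
     (1 + N%:R * \sum_i `|galerkin psi X (f i)|))).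

Lemma edmd_lipschitz_ge0 b : 0 <= b -> 0 <= edmd_lipschitz b.
Proof.
move=> b0; have g0 : 0 <= \sum_i `|galerkin psi X (f i)|.
  by apply: sumr_ge0 => i _.
have h1 : 0 <= 1 + nc%:R * (b * 2) by rewrite addr_ge0 ?mulr_ge0.
have h2 : 0 <= 1 + N%:R * \sum_i `|galerkin psi X (f i)|.
  by rewrite addr_ge0 ?mulr_ge0.
by rewrite /edmd_lipschitz /normalized_gram_inv_norm !mulr_ge0.
Qed.

(** The part of the argument that involves no probability: accuracy of all
    sample averages forces the event. *)
Lemma edmd_event_deterministic m (xs : 'I_nc.+1 -> 'I_m -> 'rV[R]_n) v b eta :
  fine (leb X) != 0 -> gram psi X \in unitmx -> `|v| <= b ->
  N%:R ^+ 2 * normalized_gram_inv_norm * eta <= 2^-1 ->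
  0 <= eta ->
  (forall p, `|m%:R^-1 * (\sum_(l < m) edmd_moment p (xs p.1.1.1 l)) -
     (fine (leb X))^-1 * \int[leb]_(x in X) edmd_moment p x| <= eta) ->
  edmd_event xs v (edmd_lipschitz b * eta).
Proof.
move=> v0 Gu vb small eta0 dev.
set c := (fine (leb X))^-1 in dev.
have cu : c \is a GRing.unit by rewrite unitfE invr_neq0.
have Cu : c *: gram psi X \in unitmx by rewrite unitmxZ.
have GE i : invmx (c *: gram psi X) *m (c *: stiffness psi X (f i)) =
    galerkin psi X (f i).
  apply: (can_inj (mulKmx Cu)); rewrite mulKVmx//.
  by rewrite -scalemxAl /galerkin mulKVmx.
have stab i : gram_hat psi (xs i) \in unitmx /\
    `|galerkin psi X (f i) - estimator psi (xs i) (f i)| <=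
    2 * N%:R * normalized_gram_inv_norm *
     (1 + N%:R * \sum_i `|galerkin psi X (f i)|) * eta.
  have [] := @invmx_mul_perturbation _ _ (c *: gram psi X)
    (c *: stiffness psi X (f i)) (gram_hat psi (xs i))
    (stiffness_hat psi (xs i) (f i)) eta Cu _ _ small.
  - apply: mx_norm_le => // k j; rewrite !mxE.
    by have := dev (i, k, j, false).
  - apply: mx_norm_le => // k j; rewrite !mxE.
    by have := dev (i, k, j, true).
  rewrite GE => u le; split=> //; apply: le_trans le _.
  rewrite ler_wpM2r// ler_wpM2l ?mulr_ge0//.
  rewrite lerD2l ler_wpM2l// (bigD1 i)//= lerDl.
  by apply: sumr_ge0 => j _.
split=> [i|]; first by case: (stab i).
rewrite control_combinationB (le_trans (frobenius_norm_le _))//.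
rewrite /edmd_lipschitz -!mulrA ler_wpM2l//.
have := control_combination_le vb (fun i => (stab i).2).
by rewrite -!mulrA.
Qed.

Lemma measurable_control_combination d (T : measurableType d)
    (D : 'I_nc.+1 -> T -> 'M[R]_N) v : (forall i, measurable_mx (D i)) ->
  measurable_mx (fun w => control_combination (fun i => D i w) v).
Proof.
move=> mD k j; under eq_fun do rewrite /control_combination mxE summxE.
apply: measurable_funD; first exact: mD.
apply: measurable_sum => l; under eq_fun do rewrite !mxE.
by apply: measurable_funM => //; apply: measurable_funB; exact: mD.
Qed.

Lemma edmd_event_measurable d (T : measurableType d) m
    (xi : 'I_nc.+1 -> 'I_m -> T -> 'rV[R]_n) v eps : 0 <= eps ->
  (forall p i l, measurable_fun [set: T] (fun w => edmd_moment p (xi i l w))) ->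
  measurable [set w | edmd_event (fun i l => xi i l w) v eps].
Proof.
move=> eps0 mh.
have mG i : measurable_mx (fun w => gram_hat psi (fun l => xi i l w)).
  move=> k j; under eq_fun do rewrite mxE.
  apply: measurable_funM => //; apply: measurable_sum => l.
  exact: (mh (i, k, j, false)).
have mS i :
    measurable_mx (fun w => stiffness_hat psi (fun l => xi i l w) (f i)).
  move=> k j; under eq_fun do rewrite mxE.
  apply: measurable_funM => //; apply: measurable_sum => l.
  exact: (mh (i, k, j, true)).
have mE i : measurable_mx (fun w => estimator psi (fun l => xi i l w) (f i)).
  by apply: measurable_mulmx => //; exact: measurable_invmx.
rewrite (_ : [set w | _] =
   (\bigcap_(i in [set: 'I_nc.+1])
     [set w | gram_hat psi (fun l => xi i l w) \in unitmx]) `&`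
   [set w | frobenius_norm
     (control_combination (fun i => galerkin psi X (f i)) v -
      control_combination (fun i => estimator psi (fun l => xi i l w) (f i)) v)
     <= eps]); last first.
  apply/seteqP; split=> w [wu we]; split=> //; first by move=> i _; exact: wu.
  by move=> i; exact: wu.
apply: measurableI.
  apply: fin_bigcap_measurable => // i _.
  rewrite -[X in measurable X]setTI; exact: measurable_unitmx.
apply: measurable_frobenius_le => // k j.
under eq_fun do rewrite control_combinationB.
move: k j; apply: (measurable_control_combination (D := fun i w =>
  galerkin psi X (f i) - estimator psi (fun l => xi i l w) (f i))) => i r s.
under eq_fun do rewrite mxE [X in _ + X]mxE.
by apply: measurable_funB => //; exact: mE.
Qed.

(** The tail bound with the accuracy [eta] of the sample averages still free. *)
Lemma edmd_event_probability d (T : measurableType d) (P : probability T R) m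
    (xi : 'I_nc.+1 -> 'I_m -> T -> 'rV[R]_n) v b eta eps :
  compact X -> (forall k x, X x -> differentiable (psi k) x) ->
  (forall k, in_L2 X (psi k)) ->
  (forall i k, in_L2 X (lie_derivative (f i) (psi k))) ->
  gram psi X \in unitmx ->
  (0 < m)%N -> (forall i, lebesgue_iid_sample P X (xi i)) ->
  `|v| <= b -> 0 < eta ->
  N%:R ^+ 2 * normalized_gram_inv_norm * eta <= 2^-1 ->
  edmd_lipschitz b * eta <= eps ->
  (P [set w | edmd_event (fun i l => xi i l w) v eps] >=
    (1 - edmd_second_moment / (m%:R * eta ^+ 2))%:E)%E.
Proof.
move=> cX dpsi psi2 lie2 Gu m0 iid vb eta0 small Keps.
have mX := compact_measurable_rV cX.
have ih p : leb.-integrable X (EFin \o edmd_moment p).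
  by apply: integrable_L2_mul => //; case: p.2.
have ih2 p : leb.-integrable X (fun x => (edmd_moment p x ^+ 2)%:E).
  have [B aB] := differentiable_bounded_on_compact cX (dpsi p.1.1.2).
  apply: integrable_bounded_L2_mul_sqr aB _ => //.
    by have [] := psi2 p.1.1.2.
  by case: p.2.
have eps0 : 0 <= eps.
  apply: le_trans Keps; rewrite mulr_ge0 ?(ltW eta0)//.
  by apply: edmd_lipschitz_ge0; exact: le_trans vb.
apply: (iid_samples_concentration (c := fun p => p.1.1.1)
  mX iid m0 ih ih2 eta0).
  apply: edmd_event_measurable => // p i l; have [mxi xiX _ _] := iid i.
  apply: (measurable_comp mX) => //; first by move=> _ [w _ <-]; exact: xiX.
  by apply/measurable_EFinP; exact: (measurable_int _ (ih p)).
move=> w dev; have v0 := iid_sample_volume_neq0 (iid ord0) m0.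
have [wu we] := edmd_event_deterministic
  (xs := fun i l => xi i l w) v0 Gu vb small (ltW eta0) dev.
by split=> //; exact: le_trans Keps.
Qed.

End edmd.

(** For [e, d <= 1] the added 1, which comes from rounding up, is at most
    [1 / (e ^+ 2 * d)], and [beta * e <= beta]; as [1 <= N ^+ 2], the factor
    [N ^+ 2] only helps. *)
Lemma sample_size_bigO (R : realType) (N : nat) (S K beta : R) :
  (0 < N)%N -> 0 <= S -> 0 <= K -> 0 <= beta ->
  (fun p : R * R =>
     (Num.truncn (S * (K + beta * p.1) ^+ 2 / (p.1 ^+ 2 * p.2))).+1%:R : R^o)
    =O_ (filter_prod 0^'+ 0^'+)
  (fun p : R * R => N%:R ^+ 2 / (p.1 ^+ 2 * p.2) : R^o).
Proof.
move=> N0 S0 K0 beta0; apply/eqOP.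
near=> k.
have kS : S * (K + beta) ^+ 2 + 1 <= k.
  by near: k; apply: nbhs_pinfty_ge; rewrite num_real.
have unit_right : \forall e \near (0 : R)^'+, 0 < e <= 1.
  near=> e; apply/andP; split; near: e.
    exact: nbhs_right_gt.
  by apply: nbhs_right_le.
exists ([set e | 0 < e <= 1], [set e | 0 < e <= 1]) => //.
move=> p [/= /andP[e0 e1] /andP[d0 d1]].
have ed0 : 0 < p.1 ^+ 2 * p.2 by rewrite mulr_gt0 ?exprn_gt0.
have ed1 : p.1 ^+ 2 * p.2 <= 1.
  by rewrite mulr_ile1 ?exprn_ile1 ?exprn_ge0 ?(ltW e0) ?(ltW d0).
have N1 : 1 <= N%:R ^+ 2 :> R by rewrite exprn_ege1// ler1n.
set x := S * _ / _.
have x0 : 0 <= x by rewrite divr_ge0 ?(ltW ed0)// mulr_ge0// sqr_ge0.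
rewrite !ger0_norm ?divr_ge0 ?(ltW ed0) ?sqr_ge0//.
have tx : (Num.truncn x).+1%:R <= x + 1 by rewrite -natr1 lerD2r truncn_le.
apply: (le_trans tx); rewrite mulrA ler_pdivlMr// mulrDl mul1r divfK ?gt_eqF//.
apply: (@le_trans _ _ k); last first.
  by rewrite ler_peMr// (le_trans _ kS)// addr_ge0// mulr_ge0 ?sqr_ge0.
apply: le_trans kS; rewrite lerD// ler_wpM2l//.
rewrite ler_sqr ?nnegrE ?addr_ge0 ?mulr_ge0 ?(ltW e0)//.
by rewrite lerD2l ler_piMr.
Unshelve. all: by end_near.
Qed.

Unset Implicit Arguments.
Set Strict Implicit.

Theorem theorem3 (R : realType) (n nc N : nat)
    (g : 'I_nc.+1 -> 'rV[R]_n -> 'rV[R]_n)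
    (X : set 'rV[R]_n) (U : set 'rV[R]_nc) (psi : 'I_N -> 'rV[R]_n -> R)
    (g_lip : forall i, locally_lipschitz (g i))
    (X_compact : compact X) (X_proper : X <> [set: 'rV[R]_n])
    (U_bounded : bounded_set U)
    (psi_diff : forall k x, X x -> differentiable (psi k) x)
    (psi_dom : forall i k,
       is_koopman_generator X (control_rhs g (unit_control i)) (psi k)
         (lie_derivative (control_rhs g (unit_control i)) (psi k)))
    (gram_inv : gram psi X \in unitmx) :
  exists mlow : R -> R -> nat,
    ((fun p : R * R => (mlow p.1 p.2)%:R : R^o)
       =O_ (filter_prod 0^'+ 0^'+)
     (fun p : R * R => N%:R ^+ 2 / (p.1 ^+ 2 * p.2) : R^o)) /\
    forall eps delta : R, 0 < eps -> 0 < delta < 1 ->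
    forall m : nat, (mlow eps delta <= m)%N ->
    forall (d : measure_display) (Omega : measurableType d)
      (P : probability Omega R) (xi : 'I_nc.+1 -> 'I_m -> Omega -> 'rV[R]_n),
    (forall i, lebesgue_iid_sample P X (xi i)) ->
    forall u : R -> 'rV[R]_nc,
    measurable_fun (`[0, +oo[ : set R) u -> (forall t, 0 <= t -> U (u t)) ->
    forall t, 0 <= t ->
    (P [set w | (forall i, gram_hat psi (fun l => xi i l w) \in unitmx) /\
          (frobenius_norm
             (control_combination
                (fun i => galerkin psi X (control_rhs g (unit_control i)))
                (u t)
              - control_combination
                (fun i => estimator psi (fun l => xi i l w)
                   (control_rhs g (unit_control i))) (u t)) <= eps)%R]
     >= (1 - delta)%:E)%E.
Proof.
(* For an empty dictionary the order N ^+ 2 forces a zero sample size; all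
   matrices are then empty and the event is certain. *)
have [N0|Npos] := posnP N.
  exists (fun _ _ => 0%N); split.
    apply/eqOP; near=> k; apply/nearW => p /=; rewrite normr0 mulr_ge0//.
  move=> eps delta eps0 /andP[d0 _] m _ d Om P xi _ u _ _ t _.
  rewrite (_ : [set w | _] = setT) ?probability_setT ?lee_fin ?gerBl ?ltW//.
  subst N; apply/seteqP; split=> // w _; split=> [i|].
    by rewrite unitmxE det_mx00 unitr1.
  by rewrite /frobenius_norm big_ord0 sqrtr0 ltW.
have psi2 k : in_L2 X (psi k) by have [] := psi_dom ord0 k.
pose f i := control_rhs g (unit_control i).
have lie2 i k : in_L2 X (lie_derivative (f i) (psi k)).
  by have [] := psi_dom i k.
have [b [b0 Ub]] : exists b : R, 0 <= b /\ forall v, U v -> `|v| <= b.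
  have [M [_ UM]] := U_bounded.
  exists (`|M| + 1); split; first by rewrite addr_ge0.
  move=> v Uv; apply: (UM (`|M| + 1)) => //.
  by rewrite (le_lt_trans (ler_norm M))// ltrDl.
(* The added 1 makes K positive, so that eta below has a positive denominator. *)
pose K := 1 + `|edmd_lipschitz psi X f b|.
(* 1 / beta is a threshold below which eta meets the smallness condition of
   the perturbation lemma. *)
pose beta := 1 + 2 * (N%:R ^+ 2 * normalized_gram_inv_norm psi X).
pose S := `|edmd_second_moment psi X f|.
have K0 : 0 < K by rewrite ltr_pwDl.
have gram0 : 0 <= normalized_gram_inv_norm psi X by exact: normr_ge0.
have beta0 : 0 <= beta by rewrite addr_ge0 ?mulr_ge0 ?sqr_ge0.
have S0 : 0 <= S by exact: normr_ge0.
exists (fun e d => (Num.truncn (S * (K + beta * e) ^+ 2 / (e ^+ 2 * d))).+1).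
split; first by apply: sample_size_bigO => //; exact: ltW.
move=> eps delta eps0 /andP[d0 d1] m mm d Om P xi iid u _ uU t t0.
have m0 : (0 < m)%N by exact: leq_trans mm.
have den0 : 0 < K + beta * eps.
  by rewrite ltr_wpDr// mulr_ge0// ltW.
pose eta := eps / (K + beta * eps).
have eta0 : 0 < eta by rewrite divr_gt0.
have etaE : (K + beta * eps) * eta = eps by rewrite mulrC divfK ?gt_eqF.
have Keta : K * eta <= eps.
  by rewrite -[leRHS]etaE ler_wpM2r ?(ltW eta0)// lerDl mulr_ge0// ltW.
have beta_eta : beta * eta <= 1.
  by rewrite mulrA ler_pdivrMr// mul1r lerDr ltW.
have m_need : S * (K + beta * eps) ^+ 2 <= m%:R * (eps ^+ 2 * delta).
  rewrite -ler_pdivrMr ?mulr_gt0 ?exprn_gt0//.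
  by rewrite (le_trans (ltW (truncnS_gt _)))// ler_nat.
apply: le_trans (edmd_event_probability (eta := eta)
  X_compact psi_diff psi2 lie2 gram_inv m0 iid (Ub _ (uU t t0)) eta0 _ _).
- have meta0 : 0 < m%:R * eta ^+ 2 by rewrite mulr_gt0 ?ltr0n// exprn_gt0.
  rewrite lee_fin lerD2l lerN2 ler_pdivrMr//.
  apply: (@le_trans _ _ S); first exact: ler_norm.
  rewrite -(@ler_pM2r _ ((K + beta * eps) ^+ 2)) ?exprn_gt0//.
  rewrite (le_trans m_need)// -[eps in leLHS]etaE exprMn le_eqVlt.
  by apply/orP; left; apply/eqP; ring.
- by move: beta_eta eta0; rewrite /beta; move: (N%:R ^+ 2 * _) => c ? ?; lra.
- rewrite (le_trans _ Keta)// ler_wpM2r ?(ltW eta0)//.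
  by rewrite (le_trans (ler_norm _))// lerDr.
Unshelve. all: by end_near.
Qed.
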